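(* Let $X$ be a metric space. Suppose $u:X\to\mathbb{R}$ is a $1$-Lipschitz map, and there is a constant $C\in[1,\infty)$ such that for every interval $I\subset\mathbb{R}$, the $\operatorname{diam}(I)$-components of the inverse image $u^{-1}(I)\subset X$ have diameter at most $C\cdot\operatorname{diam}(I)$. Then for any integer $m\ge2$ there is an admissible inverse system $\{X_i\}_{i\in\mathbb{Z}}$ with parameter $m$ and a compatible system of maps $f_i:X\to X_i$ such that: (i) the induced map $f_\infty:X\to(X_\infty,\bar d_\infty)$ is $L'$-bilipschitz, where $L'=L'(C,m)$ depends only on $C$ and $m$; (ii) $u=\phi\circ f_\infty$, where $\phi:X_\infty\to\mathbb{R}$ is the canonical $1$-Lipschitz map (well defined up to post-composition with a translation, suitably normalized).
   Context: For $\delta>0$, the $\delta$-components of a metric space are the equivalence classes of the relation: $z\sim z'$ iff there is a finite sequence $z=z_0,\dots,z_k=z'$ with $d(z_{i-1},z_i)\le\delta$ for all $i$. (The condition on $I$ is only nontrivial for bounded intervals of positive length.) A map $f$ is $L'$-bilipschitz if $L'^{-1}d(x,x')\le d(f(x),f(x'))\le L'd(x,x')$ for all $x,x'$. Graphs are identified with their geometric realizations; they need not be connected or have finite valence, and may contain isolated vertices. An inverse system of maps $\pi_i:X_{i+1}\to X_i$, $i\in\mathbb{Z}$, is admissible with parameter $m$ (an integer $\ge2$) if: (1) each $X_i$ is a nonempty directed graph; (2) if $X_i'$ is the directed graph obtained by subdividing each edge of $X_i$ into $m$ edges, then $\pi_i$ induces a map $X_{i+1}\to X_i'$ which is simplicial,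 an isomorphism on every edge, and direction preserving; (3) for all $i,j\in\mathbb{Z}$, $x\in X_i$, $x'\in X_j$, there is $k\le\min(i,j)$ such that $x,x'$ project to the same connected component of $X_k$. $X_\infty$ is the inverse limit, with projections $\pi_i^\infty:X_\infty\to X_i$. Each edge of $X_i$ is identified linearly with an interval of length $m^{-i}$. For a vertex $v$ of $X_i$, the closed star $\operatorname{St}(v,X_i)$ is the union of $\{v\}$ and all edges containing $v$. $\bar d_\infty$ is the supremal pseudo-distance on $X_\infty$ such that for every $i\in\mathbb{Z}$ and vertex $v\in X_i$, $(\pi_i^\infty)^{-1}(\operatorname{St}(v,X_i))$ has diameter at most $2m^{-i}$ (it is a metric). Maps $f_i:X\to X_i$ are compatible if $\pi_i\circ f_{i+1}=f_i$ for all $i$; they induce $f_\infty:X\to X_\infty$ with $\pi_i^\infty\circ f_\infty=f_i$. The canonical map $\phi:X_\infty\to\mathbb{R}$ is $\phi=\phi_i\circ\pi_i^\infty$ (any $i$), where $\{\phi_i:X_i\to\mathbb{R}\}$ is a system of direction preserving maps with $\phi_{i+1}=\phi_i\circ\pi_i$, each $\phi_i$ being linear on every edge of $X_i$ with image a segment of length $m^{-i}$; such a system exists and is unique up to post-composition with a translation of $\mathbb{R}$. *)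

(* Defs.v *)
From HB Require Import structures.
From mathcomp Require Import all_boot all_order all_algebra.
From mathcomp Require Import all_classical all_reals all_analysis.
From mathcomp Require Import ring lra.
From Stdlib Require Import Relation_Operators.

Set Implicit Arguments.
Unset Strict Implicit.
Unset Printing Implicit Defensive.

Import Order.TTheory GRing.Theory Num.Theory.

Local Open Scope classical_set_scope.
Local Open Scope ring_scope.

Section Diameter.
Variables (R : realType) (T : Type) (d : T -> T -> R).

(* [diam set0] is [-oo], so that every upper bound on it holds. *)
Definition diam (A : set T) : \bar R :=
  ereal_sup [set (d x y)%:E | x in A & y in A].

(* The [delta]-component of [z] in the subspace [A]. Allowing [delta] to be any
   extended real is convenient for taking [delta] to be a diameter. *)
Definition delta_component (delta : \bar R) (A : set T) (z : T) : set T :=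
  [set z' | exists (k : nat) (s : nat -> T),
     [/\ s 0%N = z, s k = z',
         forall i, (i <= k)%N -> A (s i) &
         forall i, (i < k)%N -> ((d (s i) (s i.+1))%:E <= delta)%E]].

Definition pseudo_distance : Prop :=
  [/\ forall x y, 0 <= d x y,
      forall x, d x x = 0,
      forall x y, d x y = d y x &
      forall x y z, d x z <= d x y + d y z].

End Diameter.

Definition real_dist (R : realType) (x y : R) : R := `|x - y|.

Definition bilipschitz (R : realType) (X : metricType R) (Y : Type)
    (dY : Y -> Y -> \bar R) (L : R) (f : X -> Y) : Prop :=
  forall x x', ((L^-1 * mdist x x')%:E <= dY (f x) (f x') /\
                dY (f x) (f x') <= (L * mdist x x')%:E)%E.

(* Loops, multiple edges and isolated vertices are allowed. *)
Record digraph := Digraph {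
  vtx : Type;
  edge : Type;
  src : edge -> vtx;
  tgt : edge -> vtx
}.

Record dihom (G H : digraph) := DiHom {
  vmap : vtx G -> vtx H;
  emap : edge G -> edge H;
  src_emap : forall e, src (emap e) = vmap (src e);
  tgt_emap : forall e, tgt (emap e) = vmap (tgt e)
}.

(* [subdiv_vtx m e k] is the [k]-th of the [m.+1] vertices subdividing [e],
   counted from the source of [e]. *)
Definition subdiv_vtx (m : nat) (G : digraph) (e : edge G) (k : nat) :
    vtx G + edge G * {k : nat | (0 < k < m)%N} :=
  if insub k is Some j then inr (e, j)
  else if k == 0%N then inl (src e) else inl (tgt e).

Definition subdivision (m : nat) (G : digraph) : digraph :=
  {| vtx := (vtx G + edge G * {k : nat | (0 < k < m)%N})%type;
     edge := (edge G * 'I_m)%type;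
     src := fun ek => subdiv_vtx m ek.1 ek.2;
     tgt := fun ek => subdiv_vtx m ek.1 ek.2.+1 |}.

Section Realization.
Variable R : realType.

(* The underlying set of the geometric realization. *)
Inductive gpoint (G : digraph) :=
  | Vertex of vtx G
  | Interior of edge G & {t : R | 0 < t < 1}.
Arguments Vertex {G}.
Arguments Interior {G}.

(* The affine parametrization of a closed edge by [0, 1]; values of [t] outside
   [0, 1] are irrelevant. *)
Definition edge_pt (G : digraph) (e : edge G) (t : R) : gpoint G :=
  if insub t is Some s then Interior e s
  else if t <= 0 then Vertex (src e) else Vertex (tgt e).

Definition closed_edge (G : digraph) (e : edge G) : set (gpoint G) :=
  [set edge_pt e t | t in [set t : R | 0 <= t <= 1]].

Definition star (G : digraph) (v : vtx G) : set (gpoint G) :=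
  [set Vertex v] `|`
  \bigcup_(e in [set e | closed_edge e (Vertex v)]) closed_edge e.

Definition same_component (G : digraph) : gpoint G -> gpoint G -> Prop :=
  clos_refl_sym_trans (gpoint G)
    (fun x y => exists e, closed_edge e x /\ closed_edge e y).

Definition realize (G H : digraph) (h : dihom G H) (x : gpoint G) : gpoint H :=
  match x with
  | Vertex v => Vertex (vmap h v)
  | Interior e t => Interior (emap h e) t
  end.

(* The canonical homeomorphism identifying the realizations of [G] and of its
   subdivision: the [k]-th edge subdividing [e] is [k/m, (k+1)/m]. *)
Definition unsubdivide (m : nat) (G : digraph) (x : gpoint (subdivision m G)) :
    gpoint G :=
  match x with
  | Vertex (inl v) => Vertex v
  | Vertex (inr (e, k)) => edge_pt e ((val k)%:R / m%:R)
  | Interior (e, k) t => edge_pt e ((k%:R + val t) / m%:R)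
  end.

Section InverseSystem.
Variables (m : nat) (X : int -> digraph).
Variable proj : forall i : int, gpoint (X (i + 1)) -> gpoint (X i).

(* [projects x y] : the point [x] of [X i] is mapped to the point [y] of [X k],
   for some [k <= i], by the composite [proj k \o ... \o proj (i - 1)]. *)
Inductive projects (i : int) (x : gpoint (X i)) :
    forall k : int, gpoint (X k) -> Prop :=
  | projects_refl : projects x x
  | projects_step k (y : gpoint (X (k + 1))) :
      projects x y -> projects x (proj y).

Definition admissible : Prop :=
  [/\ forall i, inhabited (gpoint (X i)),
      forall i, exists h : dihom (X (i + 1)) (subdivision m (X i)),
        forall x, proj x = unsubdivide (realize h x) &
      forall i j (x : gpoint (X i)) (x' : gpoint (X j)),
        exists (k : int) (y y' : gpoint (X k)),
          [/\ k <= Num.min i j, projects x y, projects x' y'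
            & same_component y y']].

Record invlim := InvLim {
  lim_coord :> forall i, gpoint (X i);
  proj_coord : forall i, proj (lim_coord (i + 1)) = lim_coord i
}.

Definition star_bounded (rho : invlim -> invlim -> R) : Prop :=
  forall i (v : vtx (X i)),
    (diam rho [set x : invlim | star v (x i)] <= (2 * m%:R ^ (- i))%:E)%E.

(* The supremum of a family of pseudo-distances bounded on stars has the same
   properties, so the pointwise supremum is the supremal one. For an admissible
   system it is finite. *)
Definition dbar (x y : invlim) : \bar R :=
  ereal_sup [set (rho x y)%:E |
             rho in [set rho | pseudo_distance rho /\ star_bounded rho]].

Definition compatible (T : Type) (f : forall i, T -> gpoint (X i)) : Prop :=
  forall i x, proj (f (i + 1) x) = f i x.

Definition induced_map (T : Type) (f : forall i, T -> gpoint (X i))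
    (fP : compatible f) (x : T) : invlim :=
  @InvLim (fun i => f i x) (fun i => fP i x).

(* The three clauses on an edge say that [phi_ i] is linear on it, preserves its
   direction, and has image of length [m^-i]. *)
Definition canonical_system (phi_ : forall i, gpoint (X i) -> R) : Prop :=
  (forall i x, phi_ (i + 1) x = phi_ i (proj x)) /\
  forall i (e : edge (X i)),
    [/\ forall t, 0 <= t <= 1 ->
          phi_ i (edge_pt e t) =
          (1 - t) * phi_ i (Vertex (src e)) + t * phi_ i (Vertex (tgt e)),
        phi_ i (Vertex (src e)) < phi_ i (Vertex (tgt e)) &
        `|phi_ i (Vertex (tgt e)) - phi_ i (Vertex (src e))| = m%:R ^ (- i)].

Definition canonical_map (phi : invlim -> R) : Prop :=
  exists phi_ : forall i, gpoint (X i) -> R,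
    canonical_system phi_ /\ forall i x, phi x = phi_ i (x i).

Lemma canonical_map_lipschitz (phi : invlim -> R) :
  canonical_map phi -> forall x y, ((real_dist (phi x) (phi y))%:E <= dbar x y)%E.
Proof.
move=> [phi_ [[_ phi_lin] phiE]] x y; apply: ereal_sup_ubound.
exists (fun x y => real_dist (phi x) (phi y)) => //; rewrite /real_dist; split.
  split=> *; rewrite ?subrr ?normr0 //; first exact: distrC.
  exact: ler_distD.
move=> i v; apply: ge_ereal_sup => _ [a + [b + <-]] /=.
have key (z : invlim) :
    star v (z i) -> `|phi z - phi_ i (Vertex v)| <= m%:R ^ (- i).
  rewrite (phiE i) => -[->|[e [s /= /andP[s0 s1] vE] [t /= /andP[t0 t1] <-]]].
    by rewrite subrr normr0 exprz_ge0.
  case: (phi_lin i e) => lin _ len.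
  rewrite -vE !lin ?s0 ?t0 //= -len.
  set A := phi_ _ _; set B := phi_ _ _.
  have -> : (1 - t) * A + t * B - ((1 - s) * A + s * B) = (t - s) * (B - A).
    by ring.
  rewrite normrM; apply: ler_piMl => //.
  by rewrite ler_norml; apply/andP; split; lra.
move=> /key ka /key kb; rewrite lee_fin.
apply: le_trans (ler_distD (phi_ i (Vertex v)) _ _) _.
by rewrite (distrC _ (phi b)) mulr2n mulrDl !mul1r lerD.
Qed.

End InverseSystem.
End Realization.

Arguments Vertex {R G}.
Arguments Interior {R G}.
Arguments dbar {R} m {X} proj.
Arguments canonical_map {R} m {X proj}.

(* Main.v *)
Require Import Defs.
From mathcomp Require Import all_boot all_order all_algebra.
From mathcomp Require Import all_classical all_reals all_analysis.
From mathcomp Require Import ring lra zify.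
From Stdlib Require Import Relation_Operators Operators_Properties.

Set Implicit Arguments.
Unset Strict Implicit.
Unset Printing Implicit Defensive.

Import Order.TTheory GRing.Theory Num.Theory.

Local Open Scope classical_set_scope.
Local Open Scope ring_scope.

(** Every point [x] of [X] carries a copy of the real line, and [x] sits on its
    own line at height [u x]. The graph at scale [m^-i] is obtained by cutting
    all these lines at the multiples of [m^-i] and gluing them: the lines of [x]
    and [y] are glued at height [k m^-i] when [x] and [y] lie in a common
    [m^-i]-component of the preimage under [u] of the interval [(k-1) m^-i,
    (k+1) m^-i], and along the edge from [k m^-i] to [(k+1) m^-i] when they are
    glued at both of its ends. Gluing at scale [m^-(i+1)] implies gluing at
    scale [m^-i] at the coarse heights nearby ([glued_refine]), which makes the
    identity of the lines descend to projections between the graphs. Since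
    points outside the relevant preimage are merely not glued to anything, every
    line is a full line in every graph; each point of a graph projects into a
    line ([project_to_base]), and two lines meet as soon as [m^-i] exceeds the
    distance of their points, whence admissibility ([lines_admissible]). Height
    along the lines is the canonical map, and it restricts to [u] on [X]
    ([height_lift]).

    For the upper bound, two points of [X] at distance at most [m^-i] are sent
    to one star at level [i] ([close_star]); choosing [i] with [m^-(i+1) < d x y
    <= m^-i] loses a factor [2 m].

    For the lower bound, a pseudo-distance on the whole inverse limit is needed
    which is bounded on stars and large on pairs of points of [X]. The
    hypothesis on components implies that glued points are at distance at most
    [2 C m^-i] ([glued_diam]). A point [y] of the inverse limit has, at each
    level, a nonempty set of points of [X] lying over it; these fibers decrease
    with the level, by [fiber_coord_le], and have diameter at most [2 C m^-i].
    So the function [d x0] on [X] extends to the inverse limit by taking suprema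
    of its lower bounds on fibers ([dist_ext]), the extension oscillates by at
    most [6 C m^-i] on stars ([dist_ext_star]), and the absolute difference of
    its values, divided by [3 C], competes in the supremum defining the distance
    of the inverse limit. *)

(** * Equivalence relations and representatives *)

Section RelationClosure.
Variables (T U : Type) (r : T -> T -> Prop) (r' : U -> U -> Prop).

Lemma clos_rst_map (f : T -> U) :
  (forall x y, r x y -> clos_refl_sym_trans U r' (f x) (f y)) ->
  forall x y, clos_refl_sym_trans T r x y ->
    clos_refl_sym_trans U r' (f x) (f y).
Proof.
move=> rf x y; elim=> {x y} [x y /rf//|x|x y _|x y z _ + _].
- exact: rst_refl.
- exact: rst_sym.
- exact: rst_trans.
Qed.

End RelationClosure.

Section Representative.
Variables (T : choiceType) (E : T -> T -> Prop).
Hypothesis E_refl : forall x, E x x.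
Hypothesis E_sym : forall x y, E x y -> E y x.
Hypothesis E_trans : forall x y z, E x y -> E y z -> E x z.

(** Quotients are encoded by idempotent representatives, so that the carrier
    types of the graphs below stay free of dependent proofs. *)
Definition representative (x : T) : T := xget x [set y | E x y].

Lemma representativeP x : E x (representative x).
Proof. by rewrite /representative; apply: (@xgetI _ x [set y | E x y] x). Qed.

Lemma eq_representative x y : E x y -> representative x = representative y.
Proof.
move=> xy; rewrite /representative.
have -> : [set z | E x z] = [set z | E y z].
  by apply/seteqP; split=> z /=; apply: E_trans => //; apply: E_sym.
have : exists z, `[<E y z>] by exists y; apply/asboolP; exact: E_refl.
by rewrite /xget; case: pselect.
Qed.

End Representative.

(** * Realizations and subdivisions *)

Section Realizations.
Variable R : realType.

Lemma edge_pt0 (G : digraph) (e : edge G) : edge_pt e (0 : R) = Vertex (src e).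
Proof.
by rewrite /edge_pt; case: insubP => [[t t01] /=|]; rewrite !ltxx ?lexx.
Qed.

Lemma edge_pt1 (G : digraph) (e : edge G) : edge_pt e (1 : R) = Vertex (tgt e).
Proof.
rewrite /edge_pt; case: insubP => [s|]; first by rewrite ltxx andbF.
by rewrite ler10.
Qed.

Lemma edge_pt_interior (G : digraph) (e : edge G) (t : {t : R | 0 < t < 1}) :
  edge_pt e (val t) = Interior e t.
Proof. by rewrite /edge_pt valK. Qed.

(** Points of a closed edge are compared by cases on this view: the endpoints of
    the parameter interval are vertices, so formulas on an edge have three
    cases. *)
Variant edge_pt_spec (G : digraph) (e : edge G) : R -> gpoint R G -> Prop :=
  | EdgePtSrc : edge_pt_spec e 0 (Vertex (src e))
  | EdgePtTgt : edge_pt_spec e 1 (Vertex (tgt e))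
  | EdgePtInterior t : edge_pt_spec e (val t) (Interior e t).

Lemma edge_ptP (G : digraph) (e : edge G) (t : R) :
  0 <= t <= 1 -> edge_pt_spec e t (edge_pt e t).
Proof.
case/andP; rewrite le_eqVlt => /predU1P[<- _|t0].
  by rewrite edge_pt0; constructor.
rewrite le_eqVlt => /predU1P[->|t1]; first by rewrite edge_pt1; constructor.
have t01 : 0 < t < 1 by rewrite t0.
rewrite -[t]/(val (exist (fun t : R => 0 < t < 1) t t01)) edge_pt_interior.
by constructor.
Qed.

Lemma closed_edge_src (G : digraph) (e : edge G) :
  @closed_edge R G e (Vertex (src e)).
Proof. by exists 0; rewrite ?edge_pt0 //= lexx ler01. Qed.

Lemma closed_edge_tgt (G : digraph) (e : edge G) :
  @closed_edge R G e (Vertex (tgt e)).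
Proof. by exists 1; rewrite ?edge_pt1 //= lexx ler01. Qed.

Lemma closed_edge_interior (G : digraph) (e : edge G)
    (t : {t : R | 0 < t < 1}) :
  closed_edge e (Interior e t).
Proof.
exists (val t); last exact: edge_pt_interior.
by case: t => t /= /andP[t0 t1]; rewrite !ltW.
Qed.

Lemma closed_edge_component (G : digraph) (e : edge G) (x y : gpoint R G) :
  closed_edge e x -> closed_edge e y -> same_component x y.
Proof. by move=> ex ey; apply: rst_step; exists e. Qed.

Lemma realize_edge_pt (G H : digraph) (h : dihom G H) (e : edge G) (t : R) :
  0 <= t <= 1 -> realize h (edge_pt e t) = edge_pt (emap h e) t.
Proof.
by case/edge_ptP => [||s] /=; rewrite ?edge_pt0 ?edge_pt1 ?edge_pt_interior
  ?src_emap ?tgt_emap.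
Qed.

Section Subdivision.
Variables (m : nat) (m_gt0 : (0 < m)%N).

(** Both ends [k = 0] and [k = m] are included, although there the subdividing
    vertex is an original one: this is what makes the affine formula for
    projections uniform. *)
Lemma unsubdivide_vtx (G : digraph) (e : edge G) (k : nat) : (k <= m)%N ->
  unsubdivide (@Vertex R (subdivision m G) (subdiv_vtx m e k)) =
  edge_pt e (k%:R / m%:R).
Proof.
rewrite /subdiv_vtx; case: insubP => [j _ <- //|].
have [->|k_gt0] := posnP k; first by rewrite mul0r edge_pt0.
rewrite /= => mk km.
by rewrite (_ : k = m) ?divff ?edge_pt1 ?pnatr_eq0 -?lt0n //; lia.
Qed.

Lemma unsubdivide_edge_pt (G : digraph) (e : edge G) (j : 'I_m) (t : R) :
  0 <= t <= 1 ->
  unsubdivide (@edge_pt R (subdivision m G) (e, j) t) =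
  edge_pt e ((j%:R + t) / m%:R).
Proof.
case/edge_ptP=> [||s] //; rewrite unsubdivide_vtx //= ?addr0 ?natr1 //.
exact: ltnW.
Qed.

Lemma subdivision_coord (j : 'I_m) (t : R) :
  0 <= t <= 1 -> 0 <= (j%:R + t) / m%:R <= 1.
Proof.
move=> /andP[t0 t1]; have mR : 0 < m%:R :> R by rewrite ltr0n.
rewrite divr_ge0 ?addr_ge0 ?ler0n //= ler_pdivrMr // mul1r.
by rewrite (le_trans (lerD (lexx _) t1)) // natr1 ler_nat.
Qed.

Variables (G H : digraph) (h : dihom G (subdivision m H)).
Let p (x : gpoint R G) : gpoint R H := unsubdivide (realize h x).

Lemma closed_edge_proj (e : edge G) (x : gpoint R G) :
  closed_edge e x -> closed_edge (emap h e).1 (p x).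
Proof.
move=> [t t01 <-]; rewrite /p realize_edge_pt //.
case: (emap h e) => e' j; rewrite unsubdivide_edge_pt //=.
exists ((j%:R + t) / m%:R) => //; exact: subdivision_coord.
Qed.

Lemma same_component_proj (x y : gpoint R G) :
  same_component x y -> same_component (p x) (p y).
Proof.
apply: clos_rst_map => a b [e [ea eb]].
by apply: (@closed_edge_component _ (emap h e).1); apply: closed_edge_proj.
Qed.

End Subdivision.
End Realizations.

(** * Scales *)

Section Mesh.
Variables (R : realType) (m : nat).
Hypothesis m_ge2 : (2 <= m)%N.

Definition mesh (i : int) : R := m%:R ^ (- i).

Let m_gt1 : 1 < m%:R :> R. Proof. by rewrite ltr1n. Qed.

Let m_neq0 : m%:R != 0 :> R. Proof. by rewrite pnatr_eq0; lia. Qed.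

Lemma mesh_gt0 i : 0 < mesh i.
Proof. by rewrite exprz_gt0 // ltr0n; lia. Qed.

Lemma mesh_succ i : mesh i = m%:R * mesh (i + 1).
Proof. by rewrite /mesh opprD expfzDr // exprN1 mulrCA mulfV // mulr1. Qed.

Lemma mesh_le i j : i <= j -> mesh j <= mesh i.
Proof. by move=> ij; rewrite /mesh ler_eXz2l // lerN2. Qed.

(** The level at which a given distance is visible. *)
Lemma mesh_bracket (r : R) : 0 < r -> exists i, mesh (i + 1) < r <= mesh i.
Proof.
move=> r0; have lnm : 0 < ln m%:R :> R by rewrite ln_gt0.
have meshE i : mesh i = expR (- i%:~R * ln m%:R).
  by rewrite /mesh -powR_intmul // /powR (negPf m_neq0) rmorphN.
rewrite -(lnK r0); move: (ln r) => x.
exists (Num.floor (- x / ln m%:R)).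
have /andP[] := floor_itv (- x / ln m%:R); move: (Num.floor _) => k.
rewrite ler_pdivlMr // ltr_pdivrMr // !meshE ltr_expR ler_expR intrD.
by move=> kx xk; apply/andP; split; lra.
Qed.

End Mesh.

Arguments mesh R m i : clear implicits.

(** * The inverse system of glued lines *)

Section GluedLines.
Variables (R : realType) (m : nat) (T : choiceType).
Variables (d : T -> T -> R) (u : T -> R).
Hypothesis m_ge2 : (2 <= m)%N.
Hypothesis d_pseudo : pseudo_distance d.
Hypothesis u_lip : forall x y, `|u x - u y| <= d x y.

Let m_gt0 : (0 < m)%N. Proof. exact: ltnW. Qed.
Let mZ_gt0 : 0 < m%:Z. Proof. by rewrite ltz_nat. Qed.
Let mZ_neq0 : m%:Z != 0. Proof. exact: lt0r_neq0. Qed.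

Local Notation mesh := (mesh R m).

Definition near_vertex (i k : int) (x : T) : Prop :=
  `|u x - k%:~R * mesh i| <= mesh i.

Definition step (i k : int) (x y : T) : Prop :=
  [/\ d x y <= mesh i, near_vertex i k x & near_vertex i k y].

(** The identity of points is included in [glued], so a point far from the
    height [k m^-i] forms a class by itself instead of being excluded. *)
Definition glued (i k : int) : T -> T -> Prop :=
  clos_refl_sym_trans T (step i k).

Definition edge_glued (i k : int) (x y : T) : Prop :=
  glued i k x y /\ glued i (k + 1) x y.

Definition vrep (i k : int) : T -> T := representative (glued i k).
Definition erep (i k : int) : T -> T := representative (edge_glued i k).

Lemma vrepP i k x : glued i k x (vrep i k x).
Proof. by apply: representativeP => y; apply: rst_refl. Qed.

Lemma eq_vrep i k x y : glued i k x y -> vrep i k x = vrep i k y.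
Proof.
apply: eq_representative; [exact: rst_refl|exact: rst_sym|exact: rst_trans].
Qed.

Lemma erepP i k x : edge_glued i k x (erep i k x).
Proof. by apply: representativeP => y; split; apply: rst_refl. Qed.

Lemma eq_erep i k x y : edge_glued i k x y -> erep i k x = erep i k y.
Proof.
apply: eq_representative => [z|a b|a b c].
- by split; apply: rst_refl.
- by move=> [? ?]; split; apply: rst_sym.
- by move=> [? ?] [? ?]; split; [apply: (rst_trans _ _ _ b) ..].
Qed.

Lemma vrep_erep i k x : vrep i k (erep i k x) = vrep i k x.
Proof. by apply/esym/eq_vrep; case: (erepP i k x). Qed.

Lemma vrep_succ_erep i k x : vrep i (k + 1) (erep i k x) = vrep i (k + 1) x.
Proof. by apply/esym/eq_vrep; case: (erepP i k x). Qed.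

(** The bound is strict because the star of [k] at the fine level extends one
    step of length [m^-(i+1)] beyond [k]; it must stay within the [m] steps that
    make up the star of [q] at the coarse level. *)
Lemma near_vertex_refine i k q x :
  `|k - q * m%:Z| < m%:Z -> near_vertex (i + 1) k x -> near_vertex i q x.
Proof.
move=> kq; rewrite /near_vertex (mesh_succ R m_ge2 i) => near_k.
have {}kq : `|k%:~R - q%:~R * m%:R| + 1 <= m%:R :> R.
  have : `|k - q * m%:Z| + 1 <= m%:Z by lia.
  by rewrite -(ler_int R) intrD intr_norm rmorphB rmorphM.
have -> : u x - q%:~R * (m%:R * mesh (i + 1)) =
    (u x - k%:~R * mesh (i + 1)) + (k%:~R - q%:~R * m%:R) * mesh (i + 1).
  by ring.
apply: le_trans (ler_normD _ _) _.
have s0 := mesh_gt0 R m_ge2 (i + 1).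
rewrite normrM (gtr0_norm s0); nra.
Qed.

Lemma glued_refine i k q x y :
  `|k - q * m%:Z| < m%:Z -> glued (i + 1) k x y -> glued i q x y.
Proof.
move=> kq; apply: (@clos_rst_map _ _ _ _ id) => a b [dab na nb].
apply: rst_step; split; [|exact: near_vertex_refine kq _..].
apply: le_trans dab _; apply: mesh_le => //; lia.
Qed.

(** The edge [(k, x)] is the piece of the line of [x] between heights [k] and [k
    + 1] in units of [m^-i]. Edges are not identified with one another: points
    of parallel edges already lie in a common star. A vertex [(k, x)] with [x]
    not a representative is isolated, and is mapped by the projection to a point
    of an edge, so it is connected to a line one level below. *)
Definition lines (i : int) : digraph :=
  {| vtx := int * T;
     edge := int * T;
     src := fun e => (e.1, vrep i e.1 e.2);
     tgt := fun e => (e.1 + 1, vrep i (e.1 + 1) e.2) |}.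

Lemma modz_lt (k : int) : (absz (k %% m%:Z)%Z < m)%N.
Proof. by have := ltz_pmod k mZ_gt0; have := modz_ge0 k mZ_neq0; lia. Qed.

(** Passing to representatives here is what lets the projection be well defined
    on glued vertices that fall into the interior of a coarse edge. *)
Definition coarse_edge (i k : int) (x : T) : edge (lines i) :=
  ((k %/ m%:Z)%Z, erep i (k %/ m%:Z)%Z x).

Definition coarse_vtx i (v : int * T) : vtx (subdivision m (lines i)) :=
  subdiv_vtx m (coarse_edge i v.1 v.2) (absz (v.1 %% m%:Z)%Z).

Definition coarse_subedge i (e : int * T) : edge (subdivision m (lines i)) :=
  (coarse_edge i e.1 e.2, Ordinal (modz_lt e.1)).

(** A fine vertex on a coarse vertex only needs gluing at that vertex, while one
    inside a coarse edge, where the remainder [r] is positive, is within reach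
    of both ends of the edge. *)
Lemma coarse_vtx_glued i k x y :
  glued (i + 1) k x y -> coarse_vtx i (k, x) = coarse_vtx i (k, y).
Proof.
move=> xy; rewrite /coarse_vtx /coarse_edge /=.
have := divz_eq k m%:Z; have := ltz_pmod k mZ_gt0; have := modz_ge0 k mZ_neq0.
move: (k %/ m%:Z)%Z (k %% m%:Z)%Z => q r r0 rm kE.
have xyq : glued i q x y by apply: glued_refine xy; lia.
have [r_eq0|r_neq0] := eqVneq r 0.
  by rewrite r_eq0 /subdiv_vtx insubN //= !vrep_erep (eq_vrep xyq).
suff -> : erep i q x = erep i q y by [].
by apply: eq_erep; split=> //; apply: glued_refine xy; lia.
Qed.

Lemma coarse_src i (e : edge (lines (i + 1))) :
  src (coarse_subedge i e) = coarse_vtx i (src e).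
Proof. by case: e => k x; apply: coarse_vtx_glued; apply: vrepP. Qed.

Lemma coarse_tgt i (e : edge (lines (i + 1))) :
  tgt (coarse_subedge i e) = coarse_vtx i (tgt e).
Proof.
case: e => k x /=; rewrite -(coarse_vtx_glued (vrepP (i + 1) (k + 1) x)).
rewrite /coarse_vtx /coarse_edge /=.
have := divz_eq k m%:Z; have := ltz_pmod k mZ_gt0; have := modz_ge0 k mZ_neq0.
move: (k %/ m%:Z)%Z (k %% m%:Z)%Z => q r r0 rm ->.
rewrite -addrA divzMDl // modzMDl.
have [rm1|rm1] := eqVneq (r + 1) m%:Z; last first.
  rewrite divz_small ?modz_small ?addr0; [|lia..].
  by have -> : (absz r).+1 = absz (r + 1) by lia.
have -> : (absz r).+1 = m by lia.
rewrite rm1 divzz modzz mZ_neq0 /= /subdiv_vtx !insubN ?ltnn ?andbF //=.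
by rewrite eqn0Ngt m_gt0 /= vrep_succ_erep vrep_erep.
Qed.

Definition coarsen i : dihom (lines (i + 1)) (subdivision m (lines i)) :=
  DiHom (@coarse_src i) (@coarse_tgt i).

Definition lines_proj i (p : gpoint R (lines (i + 1))) : gpoint R (lines i) :=
  unsubdivide (realize (coarsen i) p).

Lemma lines_proj_vtx i k x :
  lines_proj (Vertex ((k, x) : vtx (lines (i + 1)))) =
  edge_pt (coarse_edge i k x) ((absz (k %% m%:Z)%Z)%:R / m%:R).
Proof. exact/unsubdivide_vtx/ltnW/modz_lt. Qed.

Lemma lines_proj_edge_pt i k x (t : R) : 0 <= t <= 1 ->
  lines_proj (edge_pt ((k, x) : edge (lines (i + 1))) t) =
  edge_pt (coarse_edge i k x) (((absz (k %% m%:Z)%Z)%:R + t) / m%:R).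
Proof.
by move=> t01; rewrite /lines_proj realize_edge_pt // unsubdivide_edge_pt.
Qed.

Lemma intr_div_mod (k : int) : k%:~R =
  (k %/ m%:Z)%Z%:~R * m%:R + (absz (k %% m%:Z)%Z)%:R :> R.
Proof.
rewrite {1}(divz_eq k m%:Z) intrD intrM; congr (_ + _).
by rewrite -[RHS]/((Posz (absz _))%:~R) gez0_abs // modz_ge0.
Qed.

(** * The canonical map *)

Definition height i (p : gpoint R (lines i)) : R :=
  match p with
  | Vertex v => v.1%:~R * mesh i
  | Interior e t => (e.1%:~R + val t) * mesh i
  end.

Lemma height_edge_pt i (e : edge (lines i)) (t : R) :
  0 <= t <= 1 -> height (edge_pt e t) = (e.1%:~R + t) * mesh i.
Proof. by case/edge_ptP => //=; rewrite ?addr0 // intrD. Qed.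

Lemma height_proj i (p : gpoint R (lines (i + 1))) :
  height p = height (lines_proj p).
Proof.
have mR : m%:R != 0 :> R by rewrite pnatr_eq0 -lt0n.
have coarse k x (t : R) : 0 <= t <= 1 -> (k%:~R + t) * mesh (i + 1) =
    height (edge_pt (coarse_edge i k x)
                    (((absz (k %% m%:Z)%Z)%:R + t) / m%:R)).
  move=> t01; have c01 := subdivision_coord m_gt0 (Ordinal (modz_lt k)) t01.
  rewrite height_edge_pt //= (mesh_succ R m_ge2 i) intr_div_mod.
  by field.
case: p => [[k x]|[k x] t].
  by rewrite lines_proj_vtx /= -[k%:~R]addr0 (coarse k x) ?addr0 // lexx ler01.
rewrite -edge_pt_interior lines_proj_edge_pt -?coarse ?edge_pt_interior //.
  by case: t => t /= /andP[t0 t1]; rewrite !ltW.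
by case: t => t /= /andP[t0 t1]; rewrite !ltW.
Qed.

Lemma height_canonical : canonical_system m lines_proj height.
Proof.
split=> [i p|i [k x]]; first exact: height_proj.
have s0 := mesh_gt0 R m_ge2 i; split=> [t t01||] /=.
- by rewrite height_edge_pt //= intrD; ring.
- by rewrite ltr_pM2r // ltr_int ltrDl.
- by rewrite intrD mulrDl mul1r addrC addKr gtr0_norm.
Qed.

Lemma height_coord (y : invlim lines_proj) i : height (y i) = height (y 0).
Proof.
have step_eq j : height (y (j + 1)) = height (y j).
  by rewrite height_proj proj_coord.
elim/int_rect: i => [//|n <-|n <-]; first by rewrite -[n.+1]addn1 PoszD.
by have -> : - n%:Z = - n.+1%:Z + 1 by lia.
Qed.

Lemma lines_canonical :
  canonical_map m (fun y : invlim lines_proj => height (y 0)).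
Proof.
exists height; split=> [|i y]; first exact: height_canonical.
by rewrite height_coord.
Qed.

(** * The map from the metric space, and the upper bound *)

Lemma star_src i (e : edge (lines i)) (p : gpoint R (lines i)) :
  closed_edge e p -> star (src e) p.
Proof. by right; exists e => //; exact: closed_edge_src. Qed.

Lemma star_tgt i (e : edge (lines i)) (p : gpoint R (lines i)) :
  closed_edge e p -> star (tgt e) p.
Proof. by right; exists e => //; exact: closed_edge_tgt. Qed.

(** The line of [x] is followed up to height [u x], which lies in the edge
    indexed by the integer part of [u x] in units of [m^-i]. *)
Definition cell i (x : T) : int := Num.floor (u x / mesh i).

Definition lift i (x : T) : gpoint R (lines i) :=
  edge_pt ((cell i x, erep i (cell i x) x) : edge (lines i))
          (u x / mesh i - (cell i x)%:~R).

Lemma cell_coord i x : 0 <= u x / mesh i - (cell i x)%:~R < 1.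
Proof.
have := floor_itv (u x / mesh i); rewrite -/(cell i x) intrD => /andP[c0 c1].
by apply/andP; split; lra.
Qed.

Lemma cell_coordW i x : 0 <= u x / mesh i - (cell i x)%:~R <= 1.
Proof. by have /andP[-> /ltW] := cell_coord i x. Qed.

Lemma cell_succ i x : cell i x = (cell (i + 1) x %/ m%:Z)%Z.
Proof.
have mR : 0 < m%:R :> R by rewrite ltr0n.
have s0 := mesh_gt0 R m_ge2 (i + 1).
have /andP[c0 c1] := cell_coord (i + 1) x.
apply: floor_def; rewrite (mesh_succ R m_ge2 i) invfM mulrCA mulrC.
move: c0 c1; rewrite ler_pdivlMr // ltr_pdivrMr // -!(rmorphM _ _ m%:Z).
set a := u x / _; set k := cell _ _ => c0 c1.
have := divz_eq k m%:Z; have := ltz_pmod k mZ_gt0; have := modz_ge0 k mZ_neq0.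
move: (k %/ m%:Z)%Z (k %% m%:Z)%Z => q r r0 rm kE.
apply/andP; split.
  have : (q * m%:Z)%:~R <= k%:~R :> R by rewrite ler_int; lia.
  rewrite intrM -pmulrn; lra.
have : (k + 1)%:~R <= ((q + 1) * m%:Z)%:~R :> R by rewrite ler_int; lia.
rewrite intrM [X in X <= _]intrD -pmulrn; lra.
Qed.

Lemma lift_compatible : compatible lines_proj lift.
Proof.
move=> i x; have t01 := cell_coordW (i + 1) x.
rewrite /lift lines_proj_edge_pt // /coarse_edge -cell_succ.
have -> : erep i (cell i x) (erep (i + 1) (cell (i + 1) x) x) =
          erep i (cell i x) x.
  apply/esym/eq_erep; have [g0 g1] := erepP (i + 1) (cell (i + 1) x) x.
  rewrite cell_succ; move: (cell _ _) g0 g1 => k g0 g1.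
  have := divz_eq k m%:Z; have := ltz_pmod k mZ_gt0; have := modz_ge0 k mZ_neq0.
  move: (k %/ m%:Z)%Z (k %% m%:Z)%Z => q r r0 rm kE.
  by split; [apply: glued_refine g0|apply: glued_refine g1]; lia.
congr edge_pt; rewrite (mesh_succ R m_ge2 i) (intr_div_mod (cell (i + 1) x)).
rewrite -cell_succ.
have := lt0r_neq0 (mesh_gt0 R m_ge2 (i + 1)).
have mR : m%:R != 0 :> R by rewrite pnatr_eq0 -lt0n.
by move=> s0; field; rewrite s0 mR.
Qed.

Lemma height_lift i x : height (lift i x) = u x.
Proof.
rewrite height_edge_pt ?cell_coordW //= addrC subrK divfK //.
exact/lt0r_neq0/mesh_gt0.
Qed.

(** The point at height [k + 1] is the end of the edge starting at [k], although
    [cell] assigns it to the next edge; hence three cases. *)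
Lemma near_vertex_star i k x : near_vertex i k x ->
  star ((k, vrep i k x) : vtx (lines i)) (lift i x).
Proof.
have s0 := mesh_gt0 R m_ge2 i; rewrite /near_vertex.
have -> : u x - k%:~R * mesh i = (u x / mesh i - k%:~R) * mesh i.
  by rewrite mulrBl divfK // lt0r_neq0.
rewrite normrM (gtr0_norm s0) ger_pMl // ler_norml => /andP[kl kr].
have on_cell : closed_edge ((cell i x, erep i (cell i x) x) : edge (lines i))
    (lift i x).
  by exists (u x / mesh i - (cell i x)%:~R); rewrite //= cell_coordW.
have /andP[c0 c1] := cell_coord i x.
have kl' : k <= cell i x + 1.
  by rewrite -ltzD1 -(ltr_int R) !intrD; lra.
have kr' : cell i x <= k + 1 by rewrite -(ler_int R) intrD; lra.
have [kE|kN] := eqVneq k (cell i x).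
  by have := star_src on_cell; rewrite /= vrep_erep -kE.
have [kE|kN'] := eqVneq k (cell i x + 1).
  by have := star_tgt on_cell; rewrite /= vrep_succ_erep -kE.
have cE : cell i x = k + 1 by lia.
have cE' : (cell i x)%:~R = u x / mesh i by rewrite cE intrD in c0 *; lra.
rewrite /lift cE' subrr edge_pt0 /= vrep_erep cE.
exact: (@star_src i (k, x) _ (@closed_edge_tgt R (lines i) (k, x))).
Qed.

(** The multiple of [m^-i] just below the higher of the two points is within
    [m^-i] of both, since [u] is 1-Lipschitz. *)
Lemma close_step i x y : d x y <= mesh i -> exists k, step i k x y.
Proof.
case: d_pseudo => _ _ d_sym _.
have s0 := mesh_gt0 R m_ge2 i.
wlog xy : x y / u x <= u y.
  move=> H dxy; have [/H|/ltW yx] := leP (u x) (u y); first exact.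
  have [|k [? ? ?]] := H y x yx; first by rewrite d_sym.
  by exists k.
move=> dxy; exists (cell i y); have := cell_coord i y.
rewrite -(ler_pM2r s0) -(ltr_pM2r s0) mulrBl divfK ?lt0r_neq0 // mul0r mul1r.
move=> /andP[c0 c1]; have := le_trans (u_lip x y) dxy.
rewrite ler_norml => /andP[dl dr].
by split=> //; rewrite /near_vertex ler_norml; apply/andP; split; lra.
Qed.

Lemma close_star i x y : d x y <= mesh i ->
  exists v : vtx (lines i), star v (lift i x) /\ star v (lift i y).
Proof.
move=> /close_step[k xy]; exists (k, vrep i k x); case: (xy) => _ nx ny.
split; first exact: near_vertex_star.
by rewrite (eq_vrep (rst_step _ _ _ _ xy)); exact: near_vertex_star.
Qed.

(** * Admissibility *)

Definition base i (x : T) : gpoint R (lines i) :=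
  Vertex ((0, vrep i 0 x) : vtx (lines i)).

Lemma line_connected i (a : int) x :
  same_component (Vertex ((a, vrep i a x) : vtx (lines i))) (base i x).
Proof.
have next b : same_component (R := R)
    (Vertex ((b, vrep i b x) : vtx (lines i)))
    (Vertex ((b + 1, vrep i (b + 1) x) : vtx (lines i))).
  apply: (@closed_edge_component R (lines i) (b, x)).
    exact: (@closed_edge_src R (lines i) (b, x)).
  exact: (@closed_edge_tgt R (lines i) (b, x)).
elim/int_rect: a => [|n IH|n IH]; first exact: rst_refl.
  apply: rst_trans IH; apply: rst_sym; rewrite -[n.+1]addn1 PoszD; exact: next.
apply: rst_trans IH; have := next (- n.+1%:Z).
by have -> : - n.+1%:Z + 1 = - n%:Z by lia.
Qed.

Lemma closed_edge_base i (e : edge (lines i)) (p : gpoint R (lines i)) :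
  closed_edge e p -> same_component p (base i e.2).
Proof.
move=> ep; apply: rst_trans (line_connected i e.1 e.2).
apply: (closed_edge_component ep); exact: (@closed_edge_src R (lines i) e).
Qed.

Definition label i (p : gpoint R (lines i)) : T :=
  match p with Vertex v => v.2 | Interior e _ => e.2 end.

(** One projection suffices to bring any point onto a line, even an isolated
    vertex. *)
Lemma proj_component_base i (p : gpoint R (lines (i + 1))) :
  same_component (lines_proj p) (base i (label p)).
Proof.
have coarse k x q : closed_edge (coarse_edge i k x) q ->
    same_component q (base i x).
  move=> qe; apply: rst_trans (closed_edge_base qe) _ => /=.
  set j := (k %/ m%:Z)%Z; apply: rst_trans (line_connected i j x).
  by apply: rst_sym; rewrite -vrep_erep; exact: line_connected.
case: p => [[k x]|[k x] t]; apply: (coarse k).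
  rewrite lines_proj_vtx; exists ((absz (k %% m%:Z)%Z)%:R / m%:R) => //=.
  rewrite divr_ge0 //= ler_pdivrMr ?ltr0n // mul1r ler_nat ltnW //.
  exact: modz_lt.
exact: (closed_edge_proj m_gt0 (coarsen i)
          (@closed_edge_interior R (lines (i + 1)) (k, x) t)).
Qed.

(** The hypothesis is an equation between indices, rather than [k] being
    replaced by [i - n.+1], so that the induction needs no transport of points
    along equalities of integers. *)
Lemma project_to_base n k i (p : gpoint R (lines i)) : i = k + n.+1%:Z ->
  exists y : gpoint R (lines k),
    projects lines_proj p y /\ same_component y (base k (label p)).
Proof.
elim: n k => [|n IH] k ik.
  rewrite ik in p *; exists (lines_proj p); split.
    exact/projects_step/projects_refl.
  exact: proj_component_base.
have [|y [py yb]] := IH (k + 1); first by rewrite ik; lia.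
exists (lines_proj y); split; first exact: projects_step.
apply: rst_trans (same_component_proj m_gt0 (coarsen k) yb) _.
apply: rst_trans (proj_component_base _) _ => /=.
suff -> : base k (vrep (k + 1) 0 (label p)) = base k (label p).
  exact: rst_refl.
rewrite /base.
suff -> : vrep k 0 (vrep (k + 1) 0 (label p)) = vrep k 0 (label p) by [].
apply/esym/eq_vrep.
by apply: glued_refine (vrepP (k + 1) 0 (label p)); lia.
Qed.

(** Two lines are connected at every level [k] at which their points are within
    [m^-k] of each other. *)
Lemma lines_admissible : T -> admissible m lines_proj.
Proof.
move=> x0; split=> [i|i|i j p q].
- by constructor; exact: (base i x0).
- by exists (coarsen i).
case: (d_pseudo) => d_ge0 _ _ _.
have [|k0 /andP[_ dk0]] := @mesh_bracket R m m_ge2 (d (label p) (label q) + 1).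
  by rewrite ltr_wpDl.
pose k := Num.min k0 (Num.min i j - 1).
have [l [dxy nx ny]] : exists l, step k l (label p) (label q).
  apply: close_step; rewrite (@le_trans _ _ (mesh k0)) //; first by lra.
  by apply: mesh_le => //; rewrite ge_min lexx.
have [ki kj] : k < i /\ k < j by rewrite /k; lia.
have [y [py yb]] := @project_to_base (absz (i - k - 1)%R) k i p ltac:(lia).
have [y' [qy' yb']] := @project_to_base (absz (j - k - 1)%R) k j q ltac:(lia).
exists k, y, y'; split=> //; first by rewrite le_min !ltW.
apply: rst_trans yb _; apply: rst_sym; apply: rst_trans yb' _; apply: rst_sym.
apply: rst_trans (line_connected k l _).
have -> : vrep k l (label q) = vrep k l (label p).
  by apply/esym/eq_vrep/rst_step.
exact/rst_sym/line_connected.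
Qed.

(** * Fibers over the inverse limit, and the lower bound *)

(** The points whose lines pass through [p]; an isolated vertex is given the
    fiber of the vertex onto which its label is glued. *)
Definition fiber i (p : gpoint R (lines i)) : set T :=
  match p with
  | Vertex v => glued i v.1 v.2
  | Interior e _ => edge_glued i e.1 e.2
  end.

Lemma fiber_edge_pt i (e : edge (lines i)) (t : R) x : 0 <= t <= 1 ->
  edge_glued i e.1 e.2 x -> fiber (edge_pt e t) x.
Proof.
move=> /edge_ptP[||//] [e0 e1].
  by apply: rst_trans e0; exact/rst_sym/vrepP.
by apply: rst_trans e1; exact/rst_sym/vrepP.
Qed.

Lemma fiber_label i (p : gpoint R (lines i)) : fiber p (label p).
Proof. by case: p => [v|e t]; [|split]; exact: rst_refl. Qed.

(** The fibers over the image of a point contain the point itself: this is what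
    identifies [dist_ext] on the points of [T]. *)
Lemma fiber_lift i x : fiber (lift i x) x.
Proof.
apply: fiber_edge_pt; first exact: cell_coordW.
by have [? ?] := erepP i (cell i x) x; split; exact: rst_sym.
Qed.

Lemma fiber_glued i (p : gpoint R (lines i)) x y :
  fiber p x -> fiber p y -> exists k, glued i k x y.
Proof.
case: p => [v|e t] /= => [vx vy|[ex _] [ey _]].
  by exists v.1; apply: rst_trans vy; exact: rst_sym.
by exists e.1; apply: rst_trans ey; exact: rst_sym.
Qed.

Lemma fiber_proj i (p : gpoint R (lines (i + 1))) x :
  fiber p x -> fiber (lines_proj p) x.
Proof.
have refine k a b q : glued (i + 1) k a b -> `|k - q * m%:Z| < m%:Z ->
    glued i q a b by move=> ab kq; exact: glued_refine ab.
have coarse q a b : edge_glued i q a b -> edge_glued i q (erep i q a) b.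
  move=> [a0 a1]; have [r0 r1] := erepP i q a.
  by split; [apply: rst_trans a0|apply: rst_trans a1]; exact: rst_sym.
have r0 k := modz_ge0 k mZ_neq0; have rm k := ltz_pmod k mZ_gt0.
have kE k := divz_eq k m%:Z.
case: p => [[k a]|[k a] t] /=.
  move=> ax; rewrite lines_proj_vtx.
  move: (r0 k) (rm k) (kE k) (modz_lt k); rewrite /coarse_edge.
  move: (k %/ m%:Z)%Z (k %% m%:Z)%Z => q r {}r0 {}rm {}kE rm'.
  have axq : glued i q a x by apply: refine ax _; lia.
  have [->|r_neq0] := eqVneq r 0.
    rewrite mul0r edge_pt0 /= vrep_erep.
    by apply: rst_trans axq; exact/rst_sym/vrepP.
  apply: fiber_edge_pt.
    rewrite divr_ge0 //= ler_pdivrMr ?ltr0n // mul1r ler_nat; exact: ltnW.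
  by apply: coarse; split=> //=; apply: refine ax _; lia.
move=> [a0 a1]; have t01 : 0 <= val t <= 1.
  by case: t => t /= /andP[t0 t1]; rewrite !ltW.
rewrite -edge_pt_interior lines_proj_edge_pt //; apply: fiber_edge_pt.
  exact: (subdivision_coord m_gt0 (Ordinal (modz_lt k))).
apply: coarse; move: (r0 k) (rm k) (kE k).
move: (k %/ m%:Z)%Z (k %% m%:Z)%Z => q r {}r0 {}rm {}kE.
by split=> /=; [apply: refine a0 _|apply: refine a1 _]; lia.
Qed.

Lemma fiber_coord_le (y : invlim lines_proj) i j x :
  i <= j -> fiber (y j) x -> fiber (y i) x.
Proof.
move=> ij; have -> : j = i + (absz (j - i))%:Z by lia.
elim: (absz _) => [|n IH]; first by rewrite addr0.
by rewrite -[n.+1]addn1 PoszD addrA => /fiber_proj; rewrite proj_coord.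
Qed.

(** Stars are thicker than fibers: a vertex adjacent to [v] may have points over
    it that are not glued to [v], but some point is glued to both. *)
Lemma star_fiber i (v : vtx (lines i)) (p : gpoint R (lines i)) :
  star v p -> exists2 x, fiber p x & glued i v.1 v.2 x.
Proof.
move=> [->|[e ev [t t01 <-]]]; first by exists v.2; exact: rst_refl.
exists e.2; first by apply: fiber_edge_pt => //; split; exact: rst_refl.
case: ev => s s01; case: (edge_ptP e s01) => [[<-]|[<-]|//] /=;
  exact/rst_sym/vrepP.
Qed.

Section Distortion.
Variable K : R.
Hypothesis K_gt0 : 0 < K.
Hypothesis glued_diam : forall i k x y, glued i k x y -> d x y <= K * mesh i.

Section DistanceFunction.
Variable x0 : T.

(** The infimum of the distance to [x0] over the fiber at level [i] increases
    with [i]. Its limit is the supremum of the lower bounds at all levels. *)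
Definition dist_lower_bounds (y : invlim lines_proj) : set R :=
  [set r | exists i, forall x, fiber (y i) x -> r <= d x0 x].

Definition dist_ext (y : invlim lines_proj) : R := sup (dist_lower_bounds y).

(** Fibers at different levels are nested, so any lower bound at a level [j] is
    tested either on [x] itself or on a point of the finer fiber, which lies in
    the fiber containing [x] too. *)
Lemma dist_ext_fiber (y : invlim lines_proj) i x :
  fiber (y i) x -> `|dist_ext y - d x0 x| <= K * mesh i.
Proof.
case: (d_pseudo) => _ _ d_sym d_tri yx.
have diam_fiber j a b : fiber (y j) a -> fiber (y j) b -> d a b <= K * mesh j.
  by move=> ya yb; have [k] := fiber_glued ya yb; exact: glued_diam.
have lb : dist_lower_bounds y (d x0 x - K * mesh i).
  exists i => a ya; have := d_tri x0 a x; have := diam_fiber _ _ _ ya yx; lra.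
have ub : ubound (dist_lower_bounds y) (d x0 x + K * mesh i).
  have Ks : 0 < K * mesh i by rewrite mulr_gt0 // mesh_gt0.
  move=> r [j rj]; have [ji|/ltW ij] := leP j i.
    by have := rj _ (fiber_coord_le ji yx); lra.
  have yj := fiber_label (y j); have := rj _ yj.
  have := d_tri x0 x (label (y j)).
  have := diam_fiber _ _ _ yx (fiber_coord_le ij yj); lra.
have le1 : d x0 x - K * mesh i <= dist_ext y.
  by apply: ub_le_sup => //; exists (d x0 x + K * mesh i).
have le2 : dist_ext y <= d x0 x + K * mesh i.
  by apply: ge_sup => //; exists (d x0 x - K * mesh i).
by rewrite ler_norml; apply/andP; split; lra.
Qed.

(** One term [K m^-i] for each of the two fibers, and one for crossing from one
    to the other inside the class of [v]. *)
Lemma dist_ext_star (y y' : invlim lines_proj) i (v : vtx (lines i)) :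
  star v (y i) -> star v (y' i) ->
  `|dist_ext y - dist_ext y'| <= 3 * K * mesh i.
Proof.
case: (d_pseudo) => _ _ d_sym d_tri.
move=> /star_fiber[a ya va] /star_fiber[b yb vb].
have := dist_ext_fiber ya; have := dist_ext_fiber yb.
have : d a b <= K * mesh i.
  by apply: (@glued_diam i v.1); apply: rst_trans vb; exact: rst_sym.
have := d_tri x0 a b; have := d_tri x0 b a; rewrite (d_sym b a) !ler_norml.
move=> ? ? ? /andP[? ?] /andP[? ?]; apply/andP; split; lra.
Qed.

Lemma dist_ext_lift x : dist_ext (induced_map lift_compatible x) = d x0 x.
Proof.
set D := dist_ext _; apply/eqP; rewrite -subr_eq0 -normr_le0 leNgt.
apply/negP => D0.
have [|i /andP[si _]] := @mesh_bracket R m m_ge2 (`|D - d x0 x| / K).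
  by rewrite divr_gt0.
have := @dist_ext_fiber (induced_map lift_compatible x) (i + 1) x
  (fiber_lift _ x).
by move: si; rewrite ltr_pdivlMr // mulrC -/D; lra.
Qed.

Lemma dist_ext_star_bounded :
  star_bounded m (fun y y' => `|dist_ext y - dist_ext y'| / (3 / 2 * K)).
Proof.
move=> i v; apply: ge_ereal_sup => _ [y /= yv [y' /= yv' <-]].
have K0 : 0 < 3 / 2 * K by rewrite mulr_gt0 //; lra.
rewrite lee_fin ler_pdivrMr //.
by apply: le_trans (dist_ext_star yv yv') _; rewrite -/(mesh i); lra.
Qed.

End DistanceFunction.

(** The constant is chosen so that the oscillation [3 K m^-i] on stars becomes
    the allowed [2 m^-i]. *)
Lemma lift_lower_bound x y :
  ((d x y / (3 / 2 * K))%:E <=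
   dbar m lines_proj (induced_map lift_compatible x)
                     (induced_map lift_compatible y))%E.
Proof.
case: (d_pseudo) => d_ge0 d_refl _ _; apply: ereal_sup_ubound.
exists (fun z z' => `|dist_ext x z - dist_ext x z'| / (3 / 2 * K)).
  have K0 : 0 <= (3 / 2 * K)^-1 by rewrite invr_ge0 mulr_ge0 // ?ltW //; lra.
  split; last exact: dist_ext_star_bounded.
  split=> [z z'|z|z z'|z z' z''].
  - by rewrite mulr_ge0.
  - by rewrite subrr normr0 mul0r.
  - by rewrite distrC.
  - by rewrite -mulrDl ler_wpM2r // ler_distD.
by rewrite !dist_ext_lift d_refl sub0r normrN ger0_norm.
Qed.

End Distortion.

Lemma lift_upper_bound i x y : d x y <= mesh i ->
  (dbar m lines_proj (induced_map lift_compatible x)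
                     (induced_map lift_compatible y) <= (2 * mesh i)%:E)%E.
Proof.
move=> /close_star[v [vx vy]].
apply: ge_ereal_sup => _ [rho [_ rho_star] <-].
apply: le_trans (rho_star i v); apply: ereal_sup_ubound.
by exists (induced_map lift_compatible x) => //;
  exists (induced_map lift_compatible y).
Qed.

End GluedLines.

(** * Components and gluing *)

Section Components.
Variables (R : realType) (T : Type) (d : T -> T -> R).
Variables (delta : \bar R) (A : set T).

Lemma delta_component_refl x : A x -> delta_component d delta A x x.
Proof. by move=> Ax; exists 0%N, (fun=> x); split. Qed.

Lemma delta_component_step x y z :
  delta_component d delta A x y -> A z -> ((d y z)%:E <= delta)%E ->
  delta_component d delta A x z.
Proof.
move=> [k [s [s0 sk sA sd]]] Az yz.
exists k.+1, (fun i => if (i <= k)%N then s i else z).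
rewrite s0 ltnn; split=> // i ik.
  by case: leqP => // /sA.
rewrite -ltnS ik; case: ltnP => [/sd //|ki].
have -> : i = k by lia.
by rewrite sk.
Qed.

End Components.

(** The only glued points that need not lie in a component are equal ones, as
    [glued] is reflexive everywhere. *)
Lemma glued_component (R : realType) (m : nat) (T : choiceType)
    (d : T -> T -> R) (u : T -> R) (delta : \bar R) i k x y :
  pseudo_distance d -> ((mesh R m i)%:E <= delta)%E ->
  glued m d u i k x y ->
  x = y \/ near_vertex m u i k x /\
           delta_component d delta (near_vertex m u i k) x y.
Proof.
move=> [_ _ d_sym _] mesh_delta xy.
elim: (clos_rst_rstn1 _ _ _ _ xy) => [|y' z yz _ IH].
  by left.
have [dyz ny nz] : step m d u i k y' z.
  by case: yz => // -[? ? ?]; split=> //; rewrite d_sym.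
have close : ((d y' z)%:E <= delta)%E.
  by apply: le_trans mesh_delta; rewrite lee_fin.
right; case: IH => [->|[nx xy']]; split=> //; last first.
  exact: delta_component_step xy' _ _.
by apply: delta_component_step (delta_component_refl d delta ny) _ _.
Qed.

Lemma diam_ball (R : realType) (c r : R) : 0 <= r ->
  diam (@real_dist R) [set t | `|t - c| <= r] = (2 * r)%:E.
Proof.
move=> r0; apply/eqP; rewrite eq_le; apply/andP; split.
  apply: ge_ereal_sup => _ [s /= sr [t /= tr <-]]; rewrite lee_fin /real_dist.
  move: sr tr; rewrite !ler_norml => /andP[? ?] /andP[? ?].
  by apply/andP; split; lra.
apply: ereal_sup_ubound; exists (c + r).
  by rewrite /= addrC addKr ger0_norm.
exists (c - r); first by rewrite /= addrC addKr normrN ger0_norm.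
rewrite /real_dist; congr EFin; rewrite ger0_norm; lra.
Qed.

Lemma is_interval_ball (R : realType) (c r : R) :
  is_interval [set t | `|t - c| <= r].
Proof.
move=> x y /=; rewrite !ler_norml => /andP[? ?] /andP[? ?] z /andP[? ?].
by rewrite ler_norml; apply/andP; split; lra.
Qed.

Lemma mdist_pseudo_distance (R : realType) (X : metricType R) :
  pseudo_distance (@mdist R X).
Proof.
split; [exact: mdist_ge0|exact: mdistxx|exact: metric_sym|].
exact: metric_triangle.
Qed.

Section ComponentHypothesis.
Variables (R : realType) (C : R) (m : nat) (X : metricType R) (u : X -> R).
Hypothesis C_ge1 : 1 <= C.
Hypothesis m_ge2 : (2 <= m)%N.
Hypothesis components : forall I : set R, is_interval I ->
  forall z : X, (u @^-1` I) z ->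
    (diam mdist (delta_component mdist (diam (@real_dist R) I) (u @^-1` I) z)
       <= C%:E * diam (@real_dist R) I)%E.

(** The interval around the vertex has diameter [2 m^-i], twice the length of
    the steps allowed in [glued]; its components at its own diameter therefore
    contain the gluing classes that are not singletons. *)
Lemma glued_diam i k (x y : X) :
  glued m mdist u i k x y -> mdist x y <= 2 * C * mesh R m i.
Proof.
have s0 := mesh_gt0 R m_ge2 i => xy.
pose I := [set t : R | `|t - k%:~R * mesh R m i| <= mesh R m i].
have diamI : diam (@real_dist R) I = (2 * mesh R m i)%:E.
  by apply: diam_ball; exact: ltW.
have [|->|[nx cxy]] := glued_component (mdist_pseudo_distance X)
    (delta := diam (@real_dist R) I) _ xy.
- by rewrite diamI lee_fin; lra.
- have C0 : 0 <= C by exact: le_trans ler01 C_ge1.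
  by rewrite mdistxx !mulr_ge0 // ltW.
have xI := @components I (@is_interval_ball R _ _) x nx.
rewrite -lee_fin; apply: (@le_trans _ _ (C%:E * diam (@real_dist R) I)%E).
  apply: le_trans xI; apply: ereal_sup_ubound; exists x.
    exact: delta_component_refl.
  by exists y.
by rewrite diamI -EFinM lee_fin mulrA (mulrC C).
Qed.

End ComponentHypothesis.

(** * The realization theorem *)

Theorem theorem1p11 (R : realType) (C : R) (m : nat) :
  1 <= C -> (2 <= m)%N ->
  exists2 L' : R, 0 < L' &
    forall (X : metricType R) (u : X -> R),
      (forall x x' : X, `|u x - u x'| <= mdist x x') ->
      (forall I : set R, is_interval I ->
         forall z : X, (u @^-1` I) z ->
           (diam mdist
              (delta_component mdist (diam (@real_dist R) I) (u @^-1` I) z)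
            <= C%:E * diam (@real_dist R) I)%E) ->
      exists (G : int -> digraph)
             (proj : forall i : int, gpoint R (G (i + 1)) -> gpoint R (G i)),
        admissible m proj /\
        exists (f : forall i : int, X -> gpoint R (G i))
               (fP : compatible proj f),
          bilipschitz (dbar m proj) L' (induced_map fP) /\
          exists phi : invlim proj -> R,
            canonical_map m phi /\
            forall x : X, u x = phi (induced_map fP x).
Proof.
move=> C_ge1 m_ge2; have m_ge2R : 2 <= m%:R :> R by rewrite ler_nat.
exists (3 * C * m%:R); first by rewrite !mulr_gt0 //; lra.
move=> X u u_lip components.
(* The graphs are nonempty even if [X] is empty: then take a single line. *)
have [x0|X_empty] := pselect (inhabited X); last first.
  have unit_pseudo : pseudo_distance (fun _ _ : unit => 0 : R).
    by split=> *; rewrite ?addr0.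
  have unit_lip (x y : unit) : `|(0 : R) - 0| <= (0 : R).
    by rewrite subrr normr0.
  exists (lines m (fun _ _ : unit => 0 : R) (fun=> 0)).
  exists (@lines_proj _ _ _ _ _ m_ge2).
  split; first exact: (lines_admissible m_ge2 unit_pseudo unit_lip tt).
  exists (fun i (x : X) => False_rect _ (X_empty (inhabits x))).
  unshelve eexists; first by move=> i x; case: (X_empty (inhabits x)).
  split; first by move=> x; case: (X_empty (inhabits x)).
  eexists; split; first exact: lines_canonical.
  by move=> x; case: (X_empty (inhabits x)).
have d_pseudo := mdist_pseudo_distance X.
exists (lines m mdist u), (@lines_proj R m X mdist u m_ge2).
split.
  by case: x0 => x0; exact: (lines_admissible m_ge2 d_pseudo u_lip x0).
exists (@lift R m X mdist u), (@lift_compatible _ _ _ _ _ m_ge2).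
split; last first.
  eexists; split; first exact: lines_canonical.
  by move=> x /=; rewrite height_lift.
move=> x y; have d0 := mdist_ge0 x y; split.
  have K0 : 0 < 2 * C by lra.
  apply: le_trans (lift_lower_bound m_ge2 d_pseudo K0
    (glued_diam C_ge1 m_ge2 components) x y).
  rewrite lee_fin mulrC ler_wpM2l // lef_pV2 ?posrE ?mulr_gt0 //; try lra.
  nra.
have [->|xy] := eqVneq x y.
  rewrite mdistxx mulr0; apply: ge_ereal_sup => _ [rho [[_ rho0 _ _] _] <-].
  by rewrite rho0.
rewrite -mdist_gt0 in xy; have [i /andP[si di]] := mesh_bracket m_ge2 xy.
apply: le_trans (lift_upper_bound m_ge2 d_pseudo u_lip di) _.
have md0 : 0 <= m%:R * mdist x y by rewrite mulr_ge0.
rewrite lee_fin (mesh_succ R m_ge2 i).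
have : m%:R * mesh R m (i + 1) <= m%:R * mdist x y by rewrite ler_wpM2l // ltW.
have : 0 <= (C - 1) * (m%:R * mdist x y) by rewrite mulr_ge0 ?subr_ge0.
by lra.
Qed.
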